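(* Assume $\operatorname{cov}\mathcal{M}=\mathfrak{c}$. Then for every positive integer $n$ there exists a set $A\subset\mathbb{R}^n$ with $\dim_H A=n$ such that there is no uniformly continuous function from $A$ onto a non-degenerate closed interval of $\mathbb{R}$.
   Context: $\mathfrak{c}$ is the cardinality of the continuum, $\mathcal{M}$ is the collection of first category (meager) subsets of $\mathbb{R}$, and $\operatorname{cov}\mathcal{M}$ is the least cardinality of a family of first category subsets of $\mathbb{R}$ whose union is $\mathbb{R}$. $\dim_H$ denotes Hausdorff dimension. *)

(* Defs.v *)
From Stdlib Require Import Reals Lra.
Open Scope R_scope.

Fixpoint sumR (n : nat) (f : nat -> R) : R :=
  match n with O => 0 | S m => sumR m f + f m end.

Definition Rn (n : nat) : Type := { x : nat -> R | forall i, (n <= i)%nat -> x i = 0 }.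

Definition coord {n : nat} (p : Rn n) (i : nat) : R := proj1_sig p i.

Definition distn {n : nat} (p q : Rn n) : R :=
  sqrt (sumR n (fun i => (coord p i - coord q i) ^ 2)).

Definition diam_is {n : nat} (U : Rn n -> Prop) (d : R) : Prop :=
  ((forall x, ~ U x) /\ d = 0) \/
  is_lub (fun r => exists x y, U x /\ U y /\ r = distn x y) d.

(* d^s with the convention 0^s = 0 (s > 0) *)
Definition rpow (d s : R) : R := if Rle_dec d 0 then 0 else Rpower d s.

(* H^s(A) = 0, i.e. H^s_delta(A) = 0 for every delta > 0:
   for every delta, eps > 0 there is a countable delta-cover (U_k) of A
   with sum_k (diam U_k)^s <= eps. *)
Definition Hnull {n : nat} (s : R) (A : Rn n -> Prop) : Prop :=
  forall delta eps, 0 < delta -> 0 < eps ->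
  exists (U : nat -> Rn n -> Prop) (d : nat -> R),
    (forall x, A x -> exists k, U k x) /\
    (forall k, diam_is (U k) (d k) /\ d k <= delta) /\
    (forall N, sumR N (fun k => rpow (d k) s) <= eps).

Definition is_glb (E : R -> Prop) (m : R) : Prop :=
  (forall x, E x -> m <= x) /\ (forall b, (forall x, E x -> b <= x) -> b <= m).

Definition dimH_eq {n : nat} (A : Rn n -> Prop) (D : R) : Prop :=
  is_glb (fun s => 0 < s /\ Hnull s A) D.

Definition closureR (N : R -> Prop) (x : R) : Prop :=
  forall e, 0 < e -> exists y, N y /\ Rabs (x - y) < e.
Definition interiorR (S : R -> Prop) (x : R) : Prop :=
  exists e, 0 < e /\ forall y, Rabs (x - y) < e -> S y.
Definition nowhere_dense (N : R -> Prop) : Prop :=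
  forall x, ~ interiorR (closureR N) x.
Definition meager (M : R -> Prop) : Prop :=
  exists F : nat -> R -> Prop,
    (forall k, nowhere_dense (F k)) /\ (forall x, M x -> exists k, F k x).

(* cov(M) = c.  cov(M) <= c holds in ZFC (cover by singletons), so the
   assumption amounts to cov(M) >= c: every family of meager sets covering R
   is indexed by a set of cardinality >= c (R injects into the index set). *)
Definition covM_eq_c : Prop :=
  forall (I : Type) (F : I -> R -> Prop),
    (forall i, meager (F i)) -> (forall x, exists i, F i x) ->
    exists g : R -> I, forall x y, g x = g y -> x = y.

Definition unif_cont_on {n : nat} (A : Rn n -> Prop) (f : Rn n -> R) : Prop :=
  forall eps, 0 < eps -> exists delta, 0 < delta /\
    forall x y, A x -> A y -> distn x y < delta -> Rabs (f x - f y) < eps.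

Definition maps_onto {n : nat} (A : Rn n -> Prop) (f : Rn n -> R) (a b : R) : Prop :=
  (forall x, A x -> a <= f x <= b) /\
  (forall y, a <= y <= b -> exists x, A x /\ f x = y).

(* Main.v *)
Require Import Defs.
From Stdlib Require Import Reals.
From Stdlib Require Import Lra Lia ZArith List FinFun Wellfounded.
From Stdlib Require Import Classical ClassicalEpsilon FunctionalExtensionality.
From mathcomp Require boolp wochoice.
Import ListNotations.
Open Scope R_scope.

(** The set is built in Cantor space and carried to a cube by binary expansion of the coordinates,
    a map under which sets of Hausdorff measure zero in dimension [n] have null preimages. It suffices
    to find a non-null set [A] such that every uniformly continuous function on [A], extended to the
    closure of [A], omits some value of a fixed Cantor set of values.

    Open sets of measure at most 1/2 and uniformly continuous functions are coded by reals, and the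
    codes are well-ordered so that no initial segment has the power of the continuum. At stage [a] one
    chooses a value [u_a] whose fiber under the [a]-th function is null and contains no point chosen
    earlier, then a point [x_a] outside the [a]-th open set and outside all fibers fixed so far. The
    value exists because only countably many of the disjoint closed fibers are non-null. The point
    exists because closed null sets are nowhere dense in the support of the complement of the open
    set, which fewer than continuum many nowhere dense sets cannot cover, by the hypothesis. *)

(** * Well-orderings and transfinite recursion *)

(** The strict order is the failure of the reversed weak order [le]. A [le]-least inaccessible
    element would be accessible, and comparability comes from the uniqueness of the least element of
    a pair. *)
Lemma zermelo (T : Type) :
  exists lt : T -> T -> Prop,
    well_founded lt /\ forall a b, lt a b \/ a = b \/ lt b a.
Proof.
  destruct (wochoice.well_ordering_principle
              (eqtype.Equality.Pack (eqtype.Equality.Class (boolp.gen_eqMixin T))))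
    as [le Hle]; simpl in le, Hle.
  assert (Hmin : forall A : T -> Prop, (exists x, A x) ->
            exists z, A z /\ forall y, A y -> le z y = true).
  { intros A [x Hx].
    set (p := fun y : T => if excluded_middle_informative (A y) then true else false).
    assert (Hp : forall y, p y = true <-> A y).
    { intros y; unfold p; destruct (excluded_middle_informative (A y)); intuition discriminate. }
    destruct (Hle p) as [z [[Hz Hlow] _]].
    { exists x; apply Hp, Hx. }
    exists z; split; [apply Hp, Hz |].
    intros y Hy; apply Hlow, Hp, Hy. }
  exists (fun a b => le b a = false); split.
  - intros a; apply NNPP; intros Ha.
    destruct (Hmin (fun x => ~ Acc (fun a b => le b a = false) x) (ex_intro _ a Ha))
      as [z [Hz Hl]].
    apply Hz; constructor; intros y Hy; apply NNPP; intros Hn.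
    rewrite (Hl y Hn) in Hy; discriminate.
  - intros a b.
    destruct (le b a) eqn:Hba; [| now left].
    destruct (le a b) eqn:Hab; [| now right; right].
    right; left.
    assert (Haa : forall c, le c c = true).
    { intros c; destruct (Hmin (fun x => x = c) (ex_intro _ c eq_refl)) as [z [-> Hz]].
      now apply Hz. }
    set (p := fun y : T => if excluded_middle_informative (y = a \/ y = b) then true else false).
    assert (Hp : forall y, p y = true <-> (y = a \/ y = b)).
    { intros y; unfold p; destruct (excluded_middle_informative _); intuition discriminate. }
    destruct (Hle p) as [z [_ Hu]].
    { exists a; apply Hp; now left. }
    transitivity z; [symmetry |]; apply Hu; split; try (apply Hp; auto);
      intros y Hy; apply Hp in Hy; destruct Hy as [-> | ->]; auto.
Qed.

Definition injects (T U : Type) : Prop :=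
  exists g : T -> U, forall x y, g x = g y -> x = y.

(** Well-order the reals and let [t] be least with continuum many predecessors. The order is pulled
    back along an injection of [X] into the predecessors of [t], or along [i] if there is no such
    [t]. The segments include their endpoint. *)
Lemma small_segments (X : Type) :
  injects X R ->
  exists lt : X -> X -> Prop,
    well_founded lt /\ (forall a b, lt a b \/ a = b \/ lt b a) /\
    forall a, ~ injects R {b : X | ~ lt a b}.
Proof.
  intros [i Hi].
  destruct (zermelo R) as [lt [Hwf Htot]].
  set (full := fun t => exists g : R -> R,
         (forall x y, g x = g y -> x = y) /\ forall r, lt (g r) t).
  assert (Hj : exists j : X -> R, (forall x y, j x = j y -> x = y) /\
                 forall x, ~ full (j x)).
  { destruct (classic (exists t, full t)) as [[t Ht] | Hno].
    - revert Ht; induction t as [t IH] using (well_founded_induction Hwf); intros Ht.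
      destruct (classic (exists s, lt s t /\ full s)) as [[s [Hs Hf]] | Hmin].
      + now apply (IH s).
      + destruct Ht as [g [Hg Hlt]].
        exists (fun x => g (i x)); split.
        * intros x y H; now apply Hi, Hg.
        * intros x Hf; apply Hmin; now exists (g (i x)).
    - exists i; split; [exact Hi |]. intros x Hf; apply Hno; now exists (i x). }
  destruct Hj as [j [Hj Hsmall]].
  exists (fun a b => lt (j a) (j b)); split; [| split].
  - now apply wf_inverse_image.
  - intros a b; destruct (Htot (j a) (j b)) as [H | [H | H]]; auto.
  - intros a [g Hg].
    assert (Hval : forall r s, proj1_sig (g r) = proj1_sig (g s) -> r = s).
    { intros r s H; apply Hg.
      destruct (g r) as [u Hu], (g s) as [v Hv]; simpl in H; subst v.
      f_equal; apply proof_irrelevance. }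
    assert (Hle : forall r, lt (j (proj1_sig (g r))) (j a) \/ proj1_sig (g r) = a).
    { intros r; destruct (g r) as [u Hu]; simpl.
      destruct (Htot (j a) (j u)) as [H | [H | H]]; auto; contradiction. }
    apply (Hsmall a).
    destruct (classic (exists r0, proj1_sig (g r0) = a)) as [[r0 Hr0] | Hno].
    (* Since [exp r] is positive, [r0 + exp r] is never [r0], so this injection misses the endpoint
       [a]. *)
    + exists (fun r => j (proj1_sig (g (r0 + exp r)))); split.
      * intros x y H; apply Hj, Hval in H; apply exp_inv; lra.
      * intros r; destruct (Hle (r0 + exp r)) as [H | H]; [exact H |].
        rewrite <- Hr0 in H; apply Hval in H.
        pose proof (exp_pos r); lra.
    + exists (fun r => j (proj1_sig (g r))); split.
      * intros x y H; now apply Hval, Hj.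
      * intros r; destruct (Hle r) as [H | H]; [exact H |].
        exfalso; apply Hno; now exists r.
Qed.

(** The value at [a] is chosen by [epsilon] from the values below [a], padded by [y0] to a total
    function. The padding does no harm because [Q a] depends on its function only below [a]. *)
Lemma wf_choice (X Y : Type) (lt : X -> X -> Prop) (Q : X -> (X -> Y) -> Y -> Prop) (y0 : Y) :
  well_founded lt ->
  (forall a f g y, (forall b, lt b a -> f b = g b) -> Q a f y -> Q a g y) ->
  (forall a f, (forall b, lt b a -> Q b f (f b)) -> exists y, Q a f y) ->
  exists f, forall a, Q a f (f a).
Proof.
  intros Hwf Hext Hex.
  assert (iY : inhabited Y) by now constructor.
  set (F := fun (a : X) (prev : forall b, lt b a -> Y) =>
         epsilon iY (Q a (fun b => match excluded_middle_informative (lt b a) with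
                                   | left h => prev b h
                                   | right _ => y0 end))).
  set (f := Fix Hwf (fun _ => Y) F).
  assert (Hf : forall a, f a = F a (fun b _ => f b)).
  { intros a; apply (Fix_eq Hwf (fun _ => Y) F).
    intros x g h H. replace h with g; [reflexivity |].
    extensionality b; extensionality p; apply H. }
  exists f; intros a.
  induction a as [a IH] using (well_founded_induction Hwf).
  rewrite Hf; unfold F at 1.
  assert (Hag : forall b, lt b a -> f b =
     match excluded_middle_informative (lt b a) with left _ => f b | right _ => y0 end).
  { intros b Hb; destruct (excluded_middle_informative (lt b a)); tauto. }
  apply Hext with (f := fun b =>
     match excluded_middle_informative (lt b a) with left _ => f b | right _ => y0 end).
  { intros b Hb; symmetry; now apply Hag. }
  apply epsilon_spec.
  destruct (Hex a f IH) as [y Hy].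
  exists y; exact (Hext a f _ y Hag Hy).
Qed.

(** * Cantor space and its cylinders *)

Definition cantor : Type := nat -> bool.

(* The first [k] bits of [x], last bit first, so that extending a string is [cons]. *)
Fixpoint pre (x : cantor) (k : nat) : list bool :=
  match k with O => [] | S k => x k :: pre x k end.

Lemma pre_length x k : length (pre x k) = k.
Proof. induction k; simpl; congruence. Qed.

Lemma pre_bit x y k j : pre x k = pre y k -> (j < k)%nat -> x j = y j.
Proof.
  induction k as [| k IH]; intros H Hj; [lia |].
  injection H as H1 H2.
  destruct (Nat.eq_dec j k) as [-> | Hne]; [assumption | apply IH; [assumption | lia]].
Qed.

Lemma pre_ext x y k : (forall j, (j < k)%nat -> x j = y j) -> pre x k = pre y k.
Proof.
  induction k as [| k IH]; intros H; simpl; [reflexivity |].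
  f_equal; [apply H; lia | apply IH; intros; apply H; lia].
Qed.

Lemma pre_le x y j k : (j <= k)%nat -> pre x k = pre y k -> pre x j = pre y j.
Proof.
  intros Hjk H; apply pre_ext; intros i Hi; apply (pre_bit x y k i H); lia.
Qed.

Lemma cantor_ext (x y : cantor) : (forall k, pre x k = pre y k) -> x = y.
Proof.
  intros H; extensionality k; apply (pre_bit x y (S k)); [apply H | lia].
Qed.

Definition cyl (s : list bool) (x : cantor) : Prop := pre x (length s) = s.

Lemma cyl_pre x k : cyl (pre x k) x.
Proof. unfold cyl; now rewrite pre_length. Qed.

Lemma cyl_pre_eq x y k : cyl (pre x k) y -> pre y k = pre x k.
Proof. unfold cyl; now rewrite pre_length. Qed.

Lemma cyl_app s t x : cyl (t ++ s) x -> cyl s x.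
Proof.
  induction t as [| b t IH]; simpl; [auto |].
  unfold cyl in *; simpl; intros H; injection H as _ H; auto.
Qed.

Lemma cyl_extends s x k : cyl s x -> (length s <= k)%nat -> exists t, pre x k = t ++ s.
Proof.
  intros Hs Hk; induction Hk as [| k Hk [t IH]].
  - exists []; exact Hs.
  - exists (x k :: t); simpl; now rewrite IH.
Qed.

Lemma branch (T : list bool -> Prop) :
  T [] -> (forall s, T s -> exists b, T (b :: s)) -> exists x, forall k, T (pre x k).
Proof.
  intros H0 HS.
  set (next := fun s => epsilon (inhabits true) (fun b => T (b :: s))).
  set (st := fix st k := match k with O => [] | S k => next (st k) :: st k end).
  exists (fun k => next (st k)).
  assert (Hst : forall k, pre (fun k => next (st k)) k = st k).
  { induction k as [| k IH]; simpl; [reflexivity | now rewrite IH]. }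
  intros k; rewrite Hst.
  induction k as [| k IH]; simpl; [exact H0 |].
  apply (epsilon_spec (inhabits true) (fun b => T (b :: st k))), HS, IH.
Qed.

(** * Category *)

Definition nowhere_denseC (N : cantor -> Prop) : Prop :=
  forall s, exists t, forall x, cyl (t ++ s) x -> ~ N x.

Definition meagerC (M : cantor -> Prop) : Prop :=
  exists F : nat -> cantor -> Prop,
    (forall k, nowhere_denseC (F k)) /\ forall x, M x -> exists k, F k x.

Lemma nowhere_denseC_list (l : list cantor) : nowhere_denseC (fun x => In x l).
Proof.
  induction l as [| y l IH]; intros s.
  - exists []; auto.
  - destruct (IH s) as [t Ht].
    set (u := t ++ s) in *.
    exists (negb (y (length u)) :: t); simpl; fold u; intros x Hx Hin.
    (* The added bit is opposite to that of [y] at this position, which excludes [y]. *)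
    destruct Hin as [<- | Hin].
    + unfold cyl in Hx; simpl in Hx; injection Hx as Hx _.
      destruct (y (length u)); discriminate.
    + apply (Ht x); [| exact Hin]. now apply (cyl_app u [negb (y (length u))]).
Qed.

Lemma nowhere_denseC_sub (M N : cantor -> Prop) :
  (forall x, M x -> N x) -> nowhere_denseC N -> nowhere_denseC M.
Proof.
  intros H HN s; destruct (HN s) as [t Ht]; exists t; intros x Hx Hm.
  exact (Ht x Hx (H x Hm)).
Qed.

Lemma nowhere_dense_criterion (N : R -> Prop) :
  (forall a b, a < b -> exists c d, a <= c /\ c < d /\ d <= b /\ forall y, c < y < d -> ~ N y) ->
  nowhere_dense N.
Proof.
  intros H x [e [He Hint]].
  destruct (H (x - e) (x + e)) as [c [d [Hac [Hcd [Hdb Hfree]]]]]; [lra |].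
  (* The midpoint would be in the closure, so a point of [N] would lie within half the length of the
     free interval, hence inside it. *)
  destruct (Hint ((c + d) / 2)) with (e := (d - c) / 2) as [y [Hy Hd]].
  - apply Rabs_def1; lra.
  - lra.
  - apply Rabs_def2 in Hd; apply (Hfree y); [lra | exact Hy].
Qed.

Definition floorZ (r : R) : Z := (up r - 1)%Z.

Lemma floorZ_spec r p : floorZ r = p <-> IZR p <= r < IZR p + 1.
Proof.
  unfold floorZ; destruct (archimed r) as [H1 H2]; split.
  - intros <-; rewrite minus_IZR; lra.
  - intros [H3 H4].
    assert (p < up r)%Z by (apply lt_IZR; lra).
    assert (up r < p + 2)%Z by (apply lt_IZR; rewrite plus_IZR; lra).
    lia.
Qed.

Lemma floorZ_double r p : floorZ (2 * r) = p -> floorZ r = (p / 2)%Z.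
Proof.
  rewrite !floorZ_spec; intros [H1 H2].
  pose proof (Z.div_mod p 2 ltac:(lia)) as Hd.
  pose proof (Z.mod_pos_bound p 2 ltac:(lia)) as [Hm1 Hm2].
  apply IZR_le in Hm1; apply (f_equal IZR) in Hd.
  assert (Hm : (p mod 2 <= 1)%Z) by lia; apply IZR_le in Hm.
  rewrite plus_IZR, mult_IZR in Hd; lra.
Qed.

Definition level (z : R) (k : nat) : Z := floorZ (2 ^ k * z).

(** The binary digits of [z] from the units digit on, so that [bits] has period 2. *)
Definition bits (z : R) : cantor := fun k => Z.odd (level z k).

Lemma level_half z k : level z k = (level z (S k) / 2)%Z.
Proof.
  apply floorZ_double; unfold level; f_equal; simpl; ring.
Qed.

Lemma level_pre z w k : level z k = level w k -> pre (bits z) (S k) = pre (bits w) (S k).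
Proof.
  induction k as [| k IH]; intros H.
  - simpl; unfold bits; now rewrite H.
  - change (bits z (S k) :: pre (bits z) (S k) = bits w (S k) :: pre (bits w) (S k)).
    f_equal; [unfold bits; now rewrite H |].
    apply IH; rewrite (level_half z), (level_half w); congruence.
Qed.

(** Each bit of [t] selects a half of the current dyadic interval. An interval of level [k] fixes
    [S k] bits because [bits] starts with the units digit. *)
Lemma level_extend k p t :
  exists q, forall z, level z (length t + k) = q ->
    level z k = p /\ pre (bits z) (S (length t + k)) = t ++ pre (bits z) (S k).
Proof.
  induction t as [| b t [q IH]].
  - exists p; intros z Hz; split; [exact Hz | reflexivity].
  - exists (2 * q + if b then 1 else 0)%Z; intros z Hz.
    assert (Hq : level z (length t + k) = q).
    { rewrite level_half; change (S (length t + k)) with (length (b :: t) + k)%nat.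
      rewrite Hz; destruct b.
      - rewrite Z.add_comm, Z.mul_comm, Z.div_add; [reflexivity | lia].
      - rewrite Z.add_0_r, Z.mul_comm; apply Z.div_mul; lia. }
    destruct (IH z Hq) as [H1 H2]; split; [exact H1 |].
    change (bits z (length (b :: t) + k)%nat :: pre (bits z) (S (length t + k))
            = b :: (t ++ pre (bits z) (S k))).
    f_equal; [| exact H2].
    unfold bits; rewrite Hz.
    rewrite Z.odd_add, Z.odd_mul; now destruct b.
Qed.

Lemma pow2_large (r : R) : exists k : nat, r < 2 ^ k.
Proof.
  destruct (Pow_x_infinity 2) with (b := r + 1) as [N HN].
  - rewrite Rabs_right; lra.
  - exists N; specialize (HN N (Nat.le_refl _)).
    rewrite Rabs_right in HN; [lra |].
    apply Rle_ge, pow_le; lra.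
Qed.

Lemma nowhere_dense_bits (N : cantor -> Prop) :
  nowhere_denseC N -> nowhere_dense (fun z => N (bits z)).
Proof.
  intros HN; apply nowhere_dense_criterion; intros a b Hab.
  destruct (pow2_large (2 / (b - a))) as [k Hk].
  assert (Hpow : forall j, 0 < 2 ^ j) by (intros j; apply pow_lt; lra).
  assert (Hk2 : 2 < 2 ^ k * (b - a)).
  { apply (Rmult_lt_compat_r (b - a)) in Hk; [| lra].
    unfold Rdiv in Hk; rewrite Rmult_assoc, Rinv_l in Hk; lra. }
  (* The first dyadic interval of level [k] that starts strictly to the right of [a]. It ends before
     [b], as the distance from [a] to [b] exceeds two of its lengths. *)
  set (p := (floorZ (2 ^ k * a) + 1)%Z).
  destruct (proj1 (floorZ_spec (2 ^ k * a) _) eq_refl) as [Hp1 Hp2].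
  set (z0 := IZR p / 2 ^ k).
  assert (Hlev : forall j q, level (IZR q / 2 ^ j) j = q).
  { intros j q; apply floorZ_spec.
    replace (2 ^ j * (IZR q / 2 ^ j)) with (IZR q); [lra |].
    field; apply Rgt_not_eq, Hpow. }
  destruct (HN (pre (bits z0) (S k))) as [t Ht].
  destruct (level_extend k p t) as [q Hq].
  assert (Hin : forall z, level z k = p -> a < z < b).
  { intros z Hz; apply floorZ_spec in Hz; unfold p in Hz; rewrite plus_IZR in Hz.
    split; apply (Rmult_lt_reg_l (2 ^ k)); auto; lra. }
  set (j := (length t + k)%nat) in *.
  assert (Hlevz : forall z, IZR q / 2 ^ j <= z < (IZR q + 1) / 2 ^ j -> level z j = q).
  { intros z [H1 H2]; apply floorZ_spec.
    apply (Rmult_le_compat_l (2 ^ j)) in H1; [| left; auto].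
    apply (Rmult_lt_compat_l (2 ^ j)) in H2; [| auto].
    replace (2 ^ j * (IZR q / 2 ^ j)) with (IZR q) in H1 by (field; apply Rgt_not_eq, Hpow).
    replace (2 ^ j * ((IZR q + 1) / 2 ^ j)) with (IZR q + 1) in H2
      by (field; apply Rgt_not_eq, Hpow).
    lra. }
  assert (Hcd : IZR q / 2 ^ j < (IZR q + 1) / 2 ^ j).
  { apply Rmult_lt_compat_r; [apply Rinv_0_lt_compat; auto | lra]. }
  exists (IZR q / 2 ^ j), ((IZR q + 1) / 2 ^ j); split; [| split; [| split]].
  - left; apply Hin, Hq, Hlevz; lra.
  - exact Hcd.
  (* All points of the half-open interval are below [b]. If its right end exceeded [b], the larger
     of [b] and its left end would be a point of it that is not below [b]. *)
  - apply Rnot_lt_le; intros Hbad.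
    set (z := Rmax b (IZR q / 2 ^ j)).
    assert (Hz : level z j = q).
    { apply Hlevz; unfold z; split; [apply Rmax_r | apply Rmax_lub_lt; assumption]. }
    pose proof (proj2 (Hin z (proj1 (Hq z Hz)))) as H.
    pose proof (Rmax_l b (IZR q / 2 ^ j)); fold z in H0; lra.
  - intros z Hz.
    destruct (Hq z) as [H1 H2]; [apply Hlevz; lra |].
    apply Ht; unfold cyl; rewrite length_app, pre_length.
    rewrite Nat.add_succ_r; fold j; rewrite H2; f_equal.
    apply level_pre; rewrite H1; symmetry; apply Hlev.
Qed.

(** Preimages under [bits] of meager sets are meager in the line, so if they covered it the
    hypothesis would inject [R] into [I]. *)
Lemma covC :
  covM_eq_c ->
  forall (I : Type) (F : I -> cantor -> Prop),
    (forall i, meagerC (F i)) -> ~ injects R I -> exists x, forall i, ~ F i x.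
Proof.
  intros Hcov I F HF Hinj.
  apply NNPP; intros Hno; apply Hinj.
  apply (Hcov I (fun i z => F i (bits z))).
  - intros i; destruct (HF i) as [G [HG1 HG2]].
    exists (fun k z => G k (bits z)); split.
    + intros k; now apply nowhere_dense_bits.
    + intros z; apply HG2.
  - intros z; apply NNPP; intros Hn; apply Hno; exists (bits z); intros i Hi.
    apply Hn; now exists i.
Qed.

(** * Measure *)

(** The initial 1 acts as a leading binary digit and keeps strings of different lengths apart. *)
Fixpoint enc (s : list bool) : nat :=
  match s with [] => 1%nat | b :: s => (2 * enc s + if b then 1 else 0)%nat end.

Lemma enc_inj s t : enc s = enc t -> s = t.
Proof.
  assert (Hpos : forall u, (1 <= enc u)%nat).
  { induction u as [| b u IH]; simpl; lia. }
  revert t; induction s as [| b s IH]; intros [| c t]; simpl; intros H.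
  - reflexivity.
  - specialize (Hpos t); lia.
  - specialize (Hpos s); lia.
  - assert (b = c) by (destruct b, c; lia); subst c.
    f_equal; apply IH; lia.
Qed.

Definition weight (s : list bool) : R := (/ 2) ^ length s.

Fixpoint mass (l : list (list bool)) : R :=
  match l with [] => 0 | s :: l => weight s + mass l end.

Definition small (e : R) (S : list bool -> Prop) : Prop :=
  forall l, NoDup l -> (forall s, In s l -> S s) -> mass l <= e.

Definition covered (S : list bool -> Prop) (x : cantor) : Prop :=
  exists k, S (pre x k).

(** The null sets of the coin-tossing measure. *)
Definition null (A : cantor -> Prop) : Prop :=
  forall e, 0 < e -> exists S, small e S /\ forall x, A x -> covered S x.

Lemma mass_app l m : mass (l ++ m) = mass l + mass m.
Proof. induction l; simpl; lra. Qed.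

Lemma mass_const_length L l :
  (forall s, In s l -> length s = L) -> mass l = INR (length l) * (/ 2) ^ L.
Proof.
  induction l as [| s l IH]; intros H; [simpl; lra |].
  simpl length; rewrite S_INR; simpl mass; rewrite IH by (intros; apply H; now right).
  unfold weight; rewrite (H s) by now left.
  lra.
Qed.

Lemma mass_filter f l : mass l = mass (filter f l) + mass (filter (fun s => negb (f s)) l).
Proof.
  induction l as [| s l IH]; simpl; [lra |].
  destruct (f s); simpl; lra.
Qed.

Lemma small_sub e S S' : (forall s, S s -> S' s) -> small e S' -> small e S.
Proof. intros H HS l Hl Hin; apply HS; auto. Qed.

Lemma small_le e e' S : e <= e' -> small e S -> small e' S.
Proof. intros H HS l Hl Hin; specialize (HS l Hl Hin); lra. Qed.

(** A finite list draws on finitely many of the sets [S k]. Its mass is then bounded by splitting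
    off the strings of one such set at a time. *)
Lemma small_bigunion (S : nat -> list bool -> Prop) (e : nat -> R) (E : R) :
  (forall k, small (e k) (S k)) -> (forall N, sumR N e <= E) ->
  small E (fun s => exists k, S k s).
Proof.
  intros HS HE.
  assert (Hfin : forall N l, NoDup l -> (forall s, In s l -> exists k, (k < N)%nat /\ S k s) ->
                   mass l <= sumR N e).
  { induction N as [| N IH]; intros l Hl Hin.
    - destruct l as [| s l]; [simpl; lra |].
      destruct (Hin s (or_introl eq_refl)) as [k [Hk _]]; lia.
    - set (f := fun s => if excluded_middle_informative (S N s) then true else false).
      rewrite (mass_filter f l), Rplus_comm; simpl; apply Rplus_le_compat.
      + apply IH; [now apply NoDup_filter |].
        intros s Hs; apply filter_In in Hs; destruct Hs as [Hs Hf].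
        destruct (Hin s Hs) as [k [Hk HSk]]; exists k; split; [| exact HSk].
        destruct (Nat.eq_dec k N) as [-> |]; [| lia].
        unfold f in Hf; destruct (excluded_middle_informative (S N s)); [discriminate | tauto].
      + apply HS; [now apply NoDup_filter |].
        intros s Hs; apply filter_In in Hs; destruct Hs as [Hs Hf].
        unfold f in Hf; destruct (excluded_middle_informative (S N s)); [assumption | discriminate]. }
  intros l Hl Hin.
  assert (HN : exists N, forall s, In s l -> exists k, (k < N)%nat /\ S k s).
  { clear Hl; induction l as [| s l IH].
    - exists O; intros s [].
    - destruct IH as [N HN]; [intros; apply Hin; now right |].
      destruct (Hin s (or_introl eq_refl)) as [k Hk].
      exists (Nat.max N (k + 1)); intros u [<- | Hu].
      + exists k; split; [lia | exact Hk].
      + destruct (HN u Hu) as [j [Hj Hj']]; exists j; split; [lia | exact Hj']. }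
  destruct HN as [N HN].
  apply Rle_trans with (sumR N e); [now apply Hfin | apply HE].
Qed.

Lemma sumR_half e N : sumR N (fun k => e * (/ 2) ^ (k + 1)) = e * (1 - (/ 2) ^ N).
Proof.
  induction N as [| N IH]; simpl; [ring |].
  rewrite IH, Nat.add_1_r; simpl; field.
Qed.

Lemma sumR_half_le e N : 0 <= e -> sumR N (fun k => e * (/ 2) ^ (k + 1)) <= e.
Proof.
  intros He; rewrite sumR_half.
  assert (0 <= (/ 2) ^ N) by (apply pow_le; lra).
  nra.
Qed.

Lemma null_sub (A B : cantor -> Prop) : (forall x, A x -> B x) -> null B -> null A.
Proof.
  intros H HB e He; destruct (HB e He) as [S [HS Hc]]; exists S; split; auto.
Qed.

Lemma null_empty (A : cantor -> Prop) : (forall x, ~ A x) -> null A.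
Proof.
  intros HA e He; exists (fun _ => False); split.
  - intros [| s l] _ H; [simpl; lra | destruct (H s (or_introl eq_refl))].
  - intros x Hx; destruct (HA x Hx).
Qed.

Lemma null_bigunion (A : list bool -> cantor -> Prop) :
  (forall s, null (A s)) -> null (fun x => exists s, A s x).
Proof.
  intros HA e He.
  assert (Hex : forall s, exists S, small (e * (/ 2) ^ (enc s + 1)) S /\
                                    forall x, A s x -> covered S x).
  { intros s; apply HA, Rmult_lt_0_compat; [exact He | apply pow_lt; lra]. }
  apply choice in Hex; destruct Hex as [S HS].
  (* Numbers [k] that code no string contribute the empty set. *)
  exists (fun t => exists k s, enc s = k /\ S s t); split.
  - apply small_bigunion with (e := fun k => e * (/ 2) ^ (k + 1)).
    + intros k; destruct (classic (exists s, enc s = k)) as [[s Hs] | Hno].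
      * subst k; apply small_sub with (S' := S s); [| apply HS].
        intros t [s' [Hs' Ht]]; apply enc_inj in Hs'; now subst.
      * intros [| t l] _ Hl.
        -- simpl; apply Rmult_le_pos; [lra | apply pow_le; lra].
        -- destruct (Hl t (or_introl eq_refl)) as [s [Hs _]].
           exfalso; apply Hno; now exists s.
    + intros N; apply sumR_half_le; lra.
  - intros x [s Hs]; destruct (proj2 (HS s) x Hs) as [k Hk].
    exists k, (enc s), s; auto.
Qed.

Lemma null_union (A B : cantor -> Prop) : null A -> null B -> null (fun x => A x \/ B x).
Proof.
  intros HA HB.
  apply null_sub with (fun x => exists s : list bool, match s with [] => A x | _ => B x end).
  - intros x [H | H]; [now exists [] | now exists [true]].
  - apply null_bigunion; now intros [| b s].
Qed.

(* Descend through cylinders in which the strings of [S] keep a mass smaller than the cylinder. *)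
Lemma small_escape e S : e < 1 -> small e S -> exists x, ~ covered S x.
Proof.
  intros He HS.
  set (below := fun s u => S u /\ exists t, u = t ++ s).
  set (T := fun s => exists d, d < weight s /\ small d (below s)).
  assert (HT : forall s, T s -> ~ S s).
  { intros s [d [Hd Hs]] Hin.
    assert (H : mass [s] <= d).
    { apply Hs.
      - constructor; [easy | constructor].
      - intros u [<- | []]; split; [exact Hin | now exists []]. }
    simpl in H; lra. }
  destruct (branch T) as [x Hx].
  - exists e; split; [exact He |]. apply small_sub with (S' := S); [| exact HS].
    now intros s [Hs _].
  - intros s [d [Hd Hs]]; apply NNPP; intros Hno.
    (* If neither extension of [s] admits the bound [d / 2], both have a finite list of mass above
       [d / 2]. These lists are disjoint and together exceed [d]. *)
    assert (Hl : forall b, exists l, NoDup l /\ (forall u, In u l -> below (b :: s) u)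
                                     /\ d / 2 < mass l).
    { intros b; apply NNPP; intros Hn; apply Hno; exists b, (d / 2); split.
      - unfold weight in *; simpl; lra.
      - intros l Hl1 Hl2; apply Rnot_lt_le; intros Hm; apply Hn; now exists l. }
    destruct (Hl true) as [l1 [N1 [B1 M1]]], (Hl false) as [l2 [N2 [B2 M2]]].
    assert (Hm : mass (l1 ++ l2) <= d).
    { apply Hs.
      - apply NoDup_app; auto.
        intros u Hu1 Hu2.
        destruct (B1 u Hu1) as [_ [t1 Ht1]], (B2 u Hu2) as [_ [t2 Ht2]].
        assert (Heq : (t1 ++ [true]) ++ s = (t2 ++ [false]) ++ s).
        { rewrite <- !app_assoc; simpl; congruence. }
        apply app_inv_tail, app_inj_tail in Heq; destruct Heq; discriminate.
      - intros u Hu; apply in_app_or in Hu.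
        destruct Hu as [Hu | Hu]; [apply B1 in Hu | apply B2 in Hu];
          destruct Hu as [HSu [t ->]]; split; auto;
          [exists (t ++ [true]) | exists (t ++ [false])]; now rewrite <- app_assoc. }
    rewrite mass_app in Hm; lra.
  - exists x; intros [k Hk]; exact (HT _ (Hx k) Hk).
Qed.

Lemma small_union e d S S' :
  small e S -> small d S' -> small (e + d) (fun s => S s \/ S' s).
Proof.
  intros H H' l Hl Hin.
  set (f := fun s => if excluded_middle_informative (S s) then true else false).
  rewrite (mass_filter f l); apply Rplus_le_compat; [apply H | apply H'];
    try (now apply NoDup_filter); intros s Hs; apply filter_In in Hs;
    destruct Hs as [Hs Hf]; unfold f in Hf;
    destruct (excluded_middle_informative (S s)); try discriminate; auto.
  destruct (Hin s Hs); tauto.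
Qed.

(** A cover of the complement of mass 1/4 would complete [S] to a cover of the whole space of mass
    3/4, against [small_escape]. *)
Lemma uncovered_not_null S : small (1 / 2) S -> ~ null (fun x => ~ covered S x).
Proof.
  intros HS Hn; destruct (Hn (1 / 4)) as [S' [HS' Hc]]; [lra |].
  destruct (small_escape (1 / 2 + 1 / 4) (fun s => S s \/ S' s)) as [x Hx].
  - lra.
  - now apply small_union.
  - apply Hx; destruct (classic (covered S x)) as [[k Hk] | H].
    + exists k; now left.
    + destruct (Hc x H) as [k Hk]; exists k; now right.
Qed.

Fixpoint strings (L : nat) : list (list bool) :=
  match L with O => [[]] | S L => map (cons true) (strings L) ++ map (cons false) (strings L) end.

Lemma strings_spec s : In s (strings (length s)).
Proof.
  induction s as [| b s IH]; simpl; [now left |].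
  apply in_or_app; destruct b; [left | right]; now apply in_map.
Qed.

Lemma strings_length L : length (strings L) = (2 ^ L)%nat.
Proof.
  induction L as [| L IH]; simpl; [reflexivity |].
  rewrite length_app, !length_map, IH; lia.
Qed.

Lemma half_pow_inv L : (/ 2) ^ L * 2 ^ L = 1.
Proof. rewrite <- Rpow_mult_distr, Rinv_l by lra; apply pow1. Qed.

Lemma mass_same_length L l : NoDup l -> (forall s, In s l -> length s = L) -> mass l <= 1.
Proof.
  intros Hl Hlen; rewrite (mass_const_length L l Hlen).
  assert (Hle : (length l <= 2 ^ L)%nat).
  { rewrite <- strings_length; apply NoDup_incl_length; [exact Hl |].
    intros s Hs; rewrite <- (Hlen s Hs); apply strings_spec. }
  apply le_INR in Hle; rewrite pow_INR in Hle; change (INR 2) with 2 in Hle.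
  rewrite <- (half_pow_inv L), (Rmult_comm ((/ 2) ^ L)).
  apply Rmult_le_compat_r; [apply pow_le; lra | exact Hle].
Qed.

(** * Non-null members of a separated family *)

(** Members with distinct indices have positive distance, not merely empty intersection. For
    finitely many members, measures can then be compared by counting strings of one length. *)
Definition separated (E : cantor -> cantor -> Prop) : Prop :=
  forall u v, u <> v -> exists L, forall x y, E u x -> E v y -> pre x L <> pre y L.

Lemma separated_level E (l : list cantor) :
  separated E ->
  exists L, forall u v, In u l -> In v l -> u <> v ->
    forall x y, E u x -> E v y -> pre x L <> pre y L.
Proof.
  intros HE.
  assert (H1 : forall u, exists L, forall v, In v l -> u <> v ->
            forall x y, E u x -> E v y -> pre x L <> pre y L).
  { intros u; induction l as [| w l [L IH]]; [exists O; intros v [] |].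
    destruct (classic (u = w)) as [-> | Hne].
    - exists L; intros v [-> | Hv] Hvw; [tauto | now apply IH].
    - destruct (HE u w Hne) as [L' HL']; exists (Nat.max L L').
      intros v [-> | Hv] Huv x y Hx Hy Heq.
      + apply (HL' x y Hx Hy), (pre_le x y L' (Nat.max L L')); [lia | exact Heq].
      + apply (IH v Hv Huv x y Hx Hy), (pre_le x y L (Nat.max L L')); [lia | exact Heq]. }
  apply choice in H1; destruct H1 as [Lf HL].
  assert (Hmax : exists L, forall u, In u l -> (Lf u <= L)%nat).
  { clear HL; induction l as [| w l [L IH]]; [exists O; intros u [] |].
    exists (Nat.max L (Lf w)); intros u [-> | Hu]; [lia |]. specialize (IH u Hu); lia. }
  destruct Hmax as [L Hmax]; exists L; intros u v Hu Hv Huv x y Hx Hy Heq.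
  apply (HL u v Hv Huv x y Hx Hy), (pre_le x y _ L); [now apply Hmax | exact Heq].
Qed.

Definition bad (E : cantor -> cantor -> Prop) (e : R) (u : cantor) : Prop :=
  ~ exists S, small e S /\ forall x, E u x -> covered S x.

(* Distinct bad indices contribute disjoint sets of strings of a common length, each of mass
   more than [e], and all of them together have mass at most 1. *)
Lemma bad_bound E e l :
  separated E -> NoDup l -> (forall u, In u l -> bad E e u) -> INR (length l) * e <= 1.
Proof.
  intros HE Hl Hbad.
  destruct (separated_level E l HE) as [L HL].
  assert (H : exists m, NoDup m /\ INR (length l) * e <= mass m /\
            forall s, In s m -> exists u x, In u l /\ E u x /\ s = pre x L).
  { induction l as [| w l IH].
    - exists []; split; [constructor | split; [simpl; lra | intros s []]].
    - inversion Hl as [| ? ? Hw Hl']; subst.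
      destruct IH as [m [Hm1 [Hm2 Hm3]]]; auto.
      { intros; apply Hbad; now right. }
      { intros u v Hu Hv; apply HL; now right. }
      (* The prefixes of length [L] of the points of [E w] cover [E w]; as [w] is bad, finitely many
         of them have mass more than [e]. *)
      assert (Hn : exists m', NoDup m' /\ (forall s, In s m' -> exists x, E w x /\ s = pre x L)
                              /\ e < mass m').
      { apply NNPP; intros Hn; apply (Hbad w (or_introl eq_refl)).
        exists (fun s => exists x, E w x /\ s = pre x L); split.
        - intros m' H1 H2; apply Rnot_lt_le; intros H3; apply Hn; now exists m'.
        - intros x Hx; exists L, x; auto. }
      destruct Hn as [m' [N1 [N2 N3]]].
      exists (m' ++ m); split; [| split].
      + apply NoDup_app; auto.
        intros s H1 H2; destruct (N2 s H1) as [x [Hx Hsx]].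
        destruct (Hm3 s H2) as [u [y [Hu [Hy Hsy]]]].
        apply (HL w u) with (x := x) (y := y); auto; [now left | now right | | congruence].
        intros ->; contradiction.
      + rewrite mass_app; simpl length; rewrite S_INR; lra.
      + intros s Hs; apply in_app_or in Hs; destruct Hs as [Hs | Hs].
        * destruct (N2 s Hs) as [x [Hx Hsx]]; exists w, x; split; [now left | auto].
        * destruct (Hm3 s Hs) as [u [y [Hu [Hy Hsy]]]]; exists u, y; split; [now right | auto]. }
  destruct H as [m [H1 [H2 H3]]].
  apply Rle_trans with (mass m); [exact H2 |].
  apply (mass_same_length L m H1).
  intros s Hs; destruct (H3 s Hs) as [u [x [_ [_ ->]]]]; apply pre_length.
Qed.

Lemma bad_finite E e :
  separated E -> 0 < e -> exists l, forall u, bad E e u -> In u l.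
Proof.
  intros HE He; apply NNPP; intros Hno.
  assert (Hlong : forall N, exists l, length l = N /\ NoDup l /\ forall u, In u l -> bad E e u).
  { induction N as [| N [l [H1 [H2 H3]]]].
    - exists []; split; [reflexivity | split; [constructor | intros u []]].
    - assert (Hu : exists u, bad E e u /\ ~ In u l).
      { apply NNPP; intros Hn; apply Hno; exists l; intros u Hu.
        apply NNPP; intros Hi; apply Hn; now exists u. }
      destruct Hu as [u [Hu1 Hu2]]; exists (u :: l); split; [simpl; lia | split].
      + now constructor.
      + intros v [<- | Hv]; auto. }
  destruct (INR_unbounded (1 / e)) as [N HN].
  destruct (Hlong N) as [l [H1 [H2 H3]]].
  pose proof (bad_bound E e l HE H2 H3) as H; rewrite H1 in H.
  apply (Rmult_lt_compat_r e) in HN; [| exact He].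
  unfold Rdiv in HN; rewrite Rmult_assoc, Rinv_l in HN; lra.
Qed.

(** For each [k] only finitely many indices are bad at [/ (INR k + 1)], so the set is countable. *)
Lemma not_null_meager E : separated E -> meagerC (fun u => ~ null (E u)).
Proof.
  intros HE.
  exists (fun k => bad E (/ (INR k + 1))); split.
  - intros k.
    assert (He : 0 < / (INR k + 1)) by (apply Rinv_0_lt_compat; pose proof (pos_INR k); lra).
    destruct (bad_finite E _ HE He) as [l Hl].
    apply nowhere_denseC_sub with (1 := Hl), nowhere_denseC_list.
  - intros u Hu; apply NNPP; intros Hno; apply Hu; intros e He.
    destruct (INR_unbounded (/ e)) as [k Hk].
    apply NNPP; intros Hn; apply Hno; exists k; intros [S [HS Hc]].
    apply Hn; exists S; split; [| exact Hc].
    apply small_le with (2 := HS).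
    rewrite <- (Rinv_inv e); apply Rinv_le_contravar; [now apply Rinv_0_lt_compat | lra].
Qed.

(** * Retraction onto a tree and avoidance of closed null sets *)

Definition closedC (E : cantor -> Prop) : Prop :=
  forall x, ~ E x -> exists k, forall y, pre y k = pre x k -> ~ E y.

(** Follows [w] from its earliest bit and flips a bit whenever it would leave [T]. On infinite
    sequences this is a continuous retraction onto the branches of a tree without dead ends. *)
Fixpoint retract (T : list bool -> Prop) (w : list bool) : list bool :=
  match w with
  | [] => []
  | b :: w => let s := retract T w in
      if excluded_middle_informative (T (b :: s)) then b :: s else negb b :: s
  end.

Definition retractC (T : list bool -> Prop) (x : cantor) : cantor :=
  fun k => hd true (retract T (pre x (S k))).

Lemma retractC_pre T x k : pre (retractC T x) k = retract T (pre x k).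
Proof.
  induction k as [| k IH]; [reflexivity |].
  simpl pre at 1; rewrite IH; unfold retractC; simpl.
  now destruct (excluded_middle_informative _).
Qed.

Lemma retract_in (T : list bool -> Prop) :
  T [] -> (forall s, T s -> exists b, T (b :: s)) -> forall w, T (retract T w).
Proof.
  intros H0 HS; induction w as [| b w IH]; simpl; [exact H0 |].
  destruct (excluded_middle_informative _) as [H | H]; [exact H |].
  destruct (HS _ IH) as [c Hc].
  replace (negb b) with c; [exact Hc |].
  destruct b, c; simpl; tauto.
Qed.

(** Bits that stay in [T] are not altered. Hence the cylinder of [t ++ w] is sent into that of
    [t ++ retract T w], and relative nowhere density pulls back along the retraction. *)
Lemma retract_app (T : list bool -> Prop) t w :
  (forall b s, T (b :: s) -> T s) -> T (t ++ retract T w) ->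
  retract T (t ++ w) = t ++ retract T w.
Proof.
  intros Hd; induction t as [| b t IH]; simpl; intros H; [reflexivity |].
  rewrite IH by now apply Hd in H.
  now destruct (excluded_middle_informative _).
Qed.

(* The branches of [T] are the support of the complement of the open set given by [S]: every
   cylinder which meets this support does so in a non-null set, hence closed null sets are nowhere
   dense in it. *)
Lemma avoid_closed_null :
  covM_eq_c ->
  forall (S : list bool -> Prop) (I : Type) (E : I -> cantor -> Prop),
    small (1 / 2) S -> (forall i, closedC (E i)) -> (forall i, null (E i)) ->
    ~ injects R I -> exists x, ~ covered S x /\ forall i, ~ E i x.
Proof.
  intros Hcov S I E HS Hcl Hnull Hinj.
  set (T := fun s => ~ null (fun x => cyl s x /\ ~ covered S x)).
  assert (H0 : T []).
  { intros H; apply (uncovered_not_null S HS); apply null_sub with (2 := H).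
    intros x Hx; split; [reflexivity | exact Hx]. }
  assert (HT : forall s, T s -> exists b, T (b :: s)).
  { intros s Hs; apply NNPP; intros Hno; apply Hs.
    apply null_sub with (fun x => (cyl (true :: s) x /\ ~ covered S x) \/
                                  (cyl (false :: s) x /\ ~ covered S x)).
    - intros x [H1 H2]; destruct (x (length s)) eqn:Hb; [left | right]; split; auto;
        unfold cyl; simpl; rewrite Hb; f_equal; exact H1.
    - apply null_union; apply NNPP; intros H; apply Hno; [now exists true | now exists false]. }
  assert (Hdown : forall b s, T (b :: s) -> T s).
  { intros b s Hs H; apply Hs; apply null_sub with (2 := H).
    intros x [H1 H2]; split; [now apply (cyl_app s [b]) | exact H2]. }
  (* A cylinder given by a string of [S] is covered, so it meets the complement in the empty set and
     its string is not in [T]. *)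
  assert (Hbr : forall x, (forall k, T (pre x k)) -> ~ covered S x).
  { intros x Hx [k Hk]; apply (Hx k), null_empty; intros y [H1 H2].
    apply H2; exists k; now rewrite (cyl_pre_eq _ _ _ H1). }
  (* Otherwise every uncovered point of the cylinder of [s] lies in [E i] or in a cylinder whose
     string is outside [T]. Both parts are null, against [T s]. *)
  assert (Hnd : forall i s, T s -> exists t, T (t ++ s) /\
            forall x, (forall k, T (pre x k)) -> cyl (t ++ s) x -> ~ E i x).
  { intros i s Hs; apply NNPP; intros Hno; apply Hs.
    apply null_sub with (fun x => E i x \/
        exists u, ~ T u /\ cyl u x /\ ~ covered S x).
    - intros x [Hx1 Hx2].
      destruct (classic (exists k, ~ T (pre x k))) as [[k Hk] | Hall].
      + right; exists (pre x k); auto using cyl_pre.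
      + left; apply NNPP; intros HE.
        destruct (Hcl i x HE) as [k Hk].
        destruct (cyl_extends s x (Nat.max k (length s)) Hx1) as [t Ht]; [lia |].
        apply Hno; exists t; split.
        * rewrite <- Ht; apply NNPP; intros H; apply Hall; eauto.
        * intros y _ Hy; apply Hk; rewrite <- Ht in Hy; apply cyl_pre_eq in Hy.
          apply pre_le with (2 := Hy); lia.
    - apply null_union; [apply Hnull |]; apply null_bigunion; intros u.
      destruct (classic (T u)) as [Hu | Hu].
      + apply null_empty; tauto.
      + apply NNPP in Hu; apply null_sub with (2 := Hu); tauto. }
  (* Pulling back along the retraction lets a statement about all of Cantor space apply to the
     branches of [T]. *)
  destruct (covC Hcov I (fun i x => E i (retractC T x))) as [x Hx]; [| exact Hinj |].
  - intros i; exists (fun _ x => E i (retractC T x)); split; [| intros x Hx; now exists O].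
    intros _ w.
    destruct (Hnd i (retract T w) (retract_in T H0 HT w)) as [t [Ht1 Ht2]].
    exists t; intros x Hx; apply Ht2.
    + intros k; rewrite retractC_pre; now apply retract_in.
    + unfold cyl; rewrite retractC_pre.
      rewrite <- (retract_app T t w Hdown Ht1).
      replace (length (retract T (t ++ w))) with (length (t ++ w)).
      * now rewrite Hx.
      * generalize (t ++ w); induction l as [| b l IH]; simpl; [reflexivity |].
        destruct (excluded_middle_informative _); simpl; congruence.
  - exists (retractC T x); split; [| exact Hx].
    apply Hbr; intros k; rewrite retractC_pre; now apply retract_in.
Qed.

(** * Reals from bits *)

Definition psum (r : R) (b : cantor) (N : nat) : R :=
  sumR N (fun k => if b k then r ^ k else 0).

(** For [r] at most 1/2 the tail of the geometric series from [N] on is at most [2 * r ^ N], so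
    these bounds determine the sum of the series. The ratio 1/2 serves for coordinates, the ratio
    1/3 for the Cantor set of values. *)
Definition is_val (r : R) (b : cantor) (v : R) : Prop :=
  forall N, psum r b N <= v <= psum r b N + 2 * r ^ N.

Definition val (r : R) (b : cantor) : R := epsilon (inhabits 0) (is_val r b).

Lemma psum_step r b N : 0 < r <= / 2 ->
  psum r b N <= psum r b (S N) /\ psum r b (S N) + 2 * r ^ S N <= psum r b N + 2 * r ^ N.
Proof.
  intros Hr; unfold psum; simpl.
  assert (0 < r ^ N) by (apply pow_lt; lra).
  destruct (b N); nra.
Qed.

Lemma psum_mono r b N M : 0 < r <= / 2 -> (N <= M)%nat ->
  psum r b N <= psum r b M /\ psum r b M + 2 * r ^ M <= psum r b N + 2 * r ^ N.
Proof.
  intros Hr; induction 1 as [| M H IH]; [lra |].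
  pose proof (psum_step r b M Hr); lra.
Qed.

Lemma val_spec r b : 0 < r <= / 2 -> is_val r b (val r b).
Proof.
  intros Hr; unfold val; apply epsilon_spec.
  assert (Hpos : forall N, 0 < r ^ N) by (intros; apply pow_lt; lra).
  assert (Hub : forall N M, psum r b M <= psum r b N + 2 * r ^ N).
  { intros N M; destruct (Nat.le_ge_cases N M) as [H | H];
      pose proof (psum_mono r b _ _ Hr H); pose proof (Hpos N); pose proof (Hpos M); lra. }
  destruct (completeness (fun y => exists N, y = psum r b N)) as [v [Hv1 Hv2]].
  - exists (psum r b O + 2 * r ^ O); intros y [N ->]; apply Hub.
  - now exists (psum r b O), O.
  - exists v; intros N; split.
    + apply Hv1; now exists N.
    + apply Hv2; intros y [M ->]; apply Hub.
Qed.

Lemma psum_pre r b c k : pre b k = pre c k -> psum r b k = psum r c k.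
Proof.
  unfold psum; induction k as [| k IH]; simpl; intros H; [reflexivity |].
  injection H as H1 H2; now rewrite IH, H1.
Qed.

Lemma val_close r b c k : 0 < r <= / 2 -> pre b k = pre c k ->
  Rabs (val r b - val r c) <= 2 * r ^ k.
Proof.
  intros Hr H; pose proof (val_spec r b Hr k); pose proof (val_spec r c Hr k).
  apply (psum_pre r) in H; apply Rabs_le; lra.
Qed.

Lemma val_range r b : 0 < r <= / 2 -> 0 <= val r b <= 2.
Proof.
  intros Hr; pose proof (val_spec r b Hr O) as H; unfold psum in H; simpl in H; lra.
Qed.

(** At the first difference [c] gains [(/ 3) ^ k], while all later bits of [b] give at most two
    thirds of that. *)
Lemma val_third_lt b c k :
  pre b k = pre c k -> b k = false -> c k = true -> val (/ 3) b < val (/ 3) c.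
Proof.
  intros H Hb Hc.
  pose proof (val_spec (/ 3) b ltac:(lra) (S k)) as [_ H1].
  pose proof (val_spec (/ 3) c ltac:(lra) (S k)) as [H2 _].
  apply (psum_pre (/ 3)) in H; unfold psum in *; simpl in *.
  rewrite Hb in H1; rewrite Hc in H2.
  assert (0 < (/ 3) ^ k) by (apply pow_lt; lra).
  lra.
Qed.

Lemma val_third_inj b c : val (/ 3) b = val (/ 3) c -> b = c.
Proof.
  intros H; apply cantor_ext; induction k as [| k IH]; simpl; [reflexivity |].
  f_equal; [| exact IH].
  destruct (b k) eqn:Hb, (c k) eqn:Hc; try reflexivity.
  - pose proof (val_third_lt c b k (eq_sym IH) Hc Hb); lra.
  - pose proof (val_third_lt b c k IH Hb Hc); lra.
Qed.

(** * The set in Cantor space *)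

(* A code packs an open set of Cantor space and a family of closed sets [fiber P u]. Bits of [x] and
   of [u] are read in equal numbers, so [pre x k ++ pre u k] determines both prefixes. *)
Definition code : Type := list bool -> bool.

Definition openset (P : code) (s : list bool) : Prop := P (true :: s) = true.

Definition fiber (P : code) (u x : cantor) : Prop :=
  forall k, P (false :: pre x k ++ pre u k) = true.

(** A code is a set of strings, which [enc] turns into a 0-1 sequence and the injective ratio 1/3
    into a real. *)
Lemma code_injects : injects code R.
Proof.
  exists (fun P => val (/ 3) (fun k =>
     if excluded_middle_informative (exists s, enc s = k /\ P s = true) then true else false)).
  intros P Q H; apply val_third_inj in H; extensionality s.
  apply (f_equal (fun f => f (enc s))) in H.
  assert (Hdec : forall P : code, (exists t, enc t = enc s /\ P t = true) <-> P s = true).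
  { intros P'; split; [intros [t [Ht Hp]] | intros Hp; now exists s].
    apply enc_inj in Ht; now subst. }
  destruct (excluded_middle_informative (exists t, enc t = enc s /\ P t = true)) as [H1 | H1],
    (excluded_middle_informative (exists t, enc t = enc s /\ Q t = true)) as [H2 | H2];
    try discriminate; rewrite Hdec in H1, H2.
  - congruence.
  - destruct (P s), (Q s); congruence.
Qed.

Lemma fiber_closed P u : closedC (fiber P u).
Proof.
  intros x Hx; apply not_all_ex_not in Hx; destruct Hx as [k Hk].
  exists k; intros y Hy H; apply Hk; rewrite <- Hy; apply H.
Qed.

Lemma wf_asym (X : Type) (lt : X -> X -> Prop) :
  well_founded lt -> forall a b, lt a b -> ~ lt b a.
Proof.
  intros Hwf a; induction a as [a IH] using (well_founded_induction Hwf).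
  intros b Hab Hba; exact (IH b Hba a Hba Hab).
Qed.

(** The indices of non-null fibers form a meager set, and each [x i] lies in at most one fiber
    because fibers are disjoint. So each [i] excludes only a meager set of [u]. *)
Lemma choose_fiber :
  covM_eq_c ->
  forall (P : code) (I : Type) (x : I -> cantor),
    I -> ~ injects R I -> separated (fiber P) ->
    exists u, null (fiber P u) /\ forall i, ~ fiber P u (x i).
Proof.
  intros Hcov P I x i0 Hinj HP.
  destruct (covC Hcov I (fun i u => ~ null (fiber P u) \/ fiber P u (x i))) as [u Hu].
  - intros i; destruct (not_null_meager _ HP) as [F [HF1 HF2]].
    exists (fun k => match k with O => fun u => fiber P u (x i) | S k => F k end); split.
    + intros [| k]; [| apply HF1].
      destruct (classic (exists u, fiber P u (x i))) as [[u Hu] | Hno].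
      * apply nowhere_denseC_sub with (fun v => In v [u]); [| apply nowhere_denseC_list].
        intros v Hv; left; apply NNPP; intros Hne.
        destruct (HP u v Hne) as [L HL]; now apply (HL (x i) (x i)).
      * intros s; exists []; intros v _ Hv; apply Hno; now exists v.
    + intros u [Hu | Hu].
      * destruct (HF2 u Hu) as [k Hk]; now exists (S k).
      * now exists O.
  - exact Hinj.
  - exists u; split.
    (* The nullity condition is part of every set of the family, so one index is needed to extract
       it. *)
    + apply NNPP; intros H; apply (Hu i0); now left.
    + intros i H; apply (Hu i); now right.
Qed.

Theorem cantor_set :
  covM_eq_c ->
  exists A : cantor -> Prop, ~ null A /\
    forall P, separated (fiber P) -> exists u, forall x, A x -> ~ fiber P u x.
Proof.
  intros Hcov.
  destruct (small_segments code code_injects) as [lt [Hwf [Htot Hseg]]].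
  (* A pair holds the point first and the value second. The clauses keep earlier points out of the
     new fiber, and the new point out of the open set, the earlier fibers and the new fiber. *)
  set (Q := fun (a : code) (f : code -> cantor * cantor) (y : cantor * cantor) =>
    (separated (fiber a) -> null (fiber a (snd y)) /\
       forall b, lt b a -> ~ fiber a (snd y) (fst (f b))) /\
    (small (1 / 2) (openset a) -> ~ covered (openset a) (fst y)) /\
    (forall b, lt b a -> separated (fiber b) -> ~ fiber b (snd (f b)) (fst y)) /\
    (separated (fiber a) -> ~ fiber a (snd y) (fst y))).
  destruct (wf_choice code (cantor * cantor) lt Q (fun _ => true, fun _ => true) Hwf)
    as [f Hf].
  - intros a f g y Hfg [H1 [H2 [H3 H4]]]; split; [| split; [exact H2 | split; [| exact H4]]].
    + intros Ha; split; [now apply H1 |].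
      intros b Hb; rewrite <- Hfg by exact Hb; now apply H1.
    + intros b Hb; rewrite <- Hfg by exact Hb; now apply H3.
  - intros a f IH.
    assert (Haa : ~ lt a a) by (intros H; exact (wf_asym _ _ Hwf a a H H)).
    set (I := {b : code | ~ lt a b}).
    assert (Hu : exists u, separated (fiber a) -> null (fiber a u) /\
                   forall b, lt b a -> ~ fiber a u (fst (f b))).
    { destruct (classic (separated (fiber a))) as [Ha | Ha];
        [| exists (fun _ => true); tauto].
      destruct (choose_fiber Hcov a I (fun i => fst (f (proj1_sig i))) (exist _ a Haa) (Hseg a) Ha)
        as [u [Hu1 Hu2]].
      exists u; intros _; split; [exact Hu1 |].
      intros b Hb.
      exact (Hu2 (exist _ b (wf_asym _ _ Hwf b a Hb))). }
    destruct Hu as [u Hu].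
    (* The values fixed up to and including stage [a], so that the new point avoids earlier fibers
       and its own in one application. *)
    set (g := fun b => if excluded_middle_informative (lt b a) then snd (f b) else u).
    assert (Hg1 : forall b, lt b a -> g b = snd (f b)).
    { intros b Hb; unfold g; destruct (excluded_middle_informative (lt b a)); tauto. }
    assert (Hg2 : g a = u).
    { unfold g; destruct (excluded_middle_informative (lt a a)); tauto. }
    (* An open set that is too large, or a fiber of a code that is not separated, is replaced by the
       empty set. *)
    destruct (avoid_closed_null Hcov (fun s => small (1 / 2) (openset a) /\ openset a s) I
                (fun i x => separated (fiber (proj1_sig i)) /\
                            fiber (proj1_sig i) (g (proj1_sig i)) x)) as [x [Hx1 Hx2]].
    + destruct (classic (small (1 / 2) (openset a))) as [H | H].
      * apply small_sub with (2 := H); tauto.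
      * intros [| s l] _ Hl; [simpl; lra | destruct (Hl s (or_introl eq_refl)); tauto].
    + intros [b Hb] x; simpl; intros Hx.
      destruct (classic (separated (fiber b))) as [H | H]; [| exists O; tauto].
      destruct (fiber_closed b (g b) x) as [k Hk]; [tauto |].
      exists k; intros y Hy; specialize (Hk y Hy); tauto.
    + intros [b Hb]; simpl.
      destruct (classic (separated (fiber b))) as [H | H]; [| apply null_empty; tauto].
      apply null_sub with (fiber b (g b)); [tauto |].
      destruct (Htot b a) as [Hlt | [-> | Hlt]]; [| | contradiction].
      * rewrite Hg1 by exact Hlt; now apply (IH b Hlt).
      * rewrite Hg2; now apply Hu.
    + apply Hseg.
    + assert (Hx3 : forall b, ~ lt a b -> separated (fiber b) -> ~ fiber b (g b) x).
      { intros b Hb Hs Hfb; exact (Hx2 (exist _ b Hb) (conj Hs Hfb)). }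
      exists (x, u); split; [exact Hu | split; [| split]]; simpl.
      * intros Hs [k Hk]; apply Hx1; now exists k.
      * intros b Hb; rewrite <- Hg1 by exact Hb; apply Hx3.
        now apply (wf_asym _ _ Hwf).
      * rewrite <- Hg2; now apply Hx3.
  - exists (fun x => exists a, x = fst (f a)); split.
    (* A cover of mass 1/2 is the open set of some code [a], and the point of stage [a] avoids
       it. *)
    + intros Hn; destruct (Hn (1 / 2)) as [S [HS Hc]]; [lra |].
      set (a := fun s : list bool => match s with
                | true :: s => if excluded_middle_informative (S s) then true else false
                | _ => false end).
      assert (Ha : forall s, openset a s <-> S s).
      { intros s; unfold openset, a; destruct (excluded_middle_informative (S s));
          intuition discriminate. }
      destruct (Hf a) as [_ [H _]]; apply H.
      * apply small_sub with (2 := HS); intros s; apply Ha.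
      * destruct (Hc (fst (f a))) as [k Hk]; [now exists a |].
        exists k; now apply Ha.
    (* Points chosen before, at and after stage [P] are excluded by the first, fourth and third
       clause of [Q]. *)
    + intros P HP; exists (snd (f P)); intros x [b ->].
      destruct (Htot b P) as [H | [-> | H]].
      * now apply (Hf P).
      * now apply (Hf P).
      * now apply (Hf b).
Qed.

(** * Hausdorff measure *)

Lemma sumR_le N f g : (forall k, (k < N)%nat -> f k <= g k) -> sumR N f <= sumR N g.
Proof.
  induction N as [| N IH]; intros H; simpl; [lra |].
  apply Rplus_le_compat; [apply IH; intros; apply H; lia | apply H; lia].
Qed.

Lemma sumR_lin N a f g : sumR N (fun k => a * f k + g k) = a * sumR N f + sumR N g.
Proof. induction N as [| N IH]; simpl; [ring | rewrite IH; ring]. Qed.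

Lemma sumR_term N f i : (forall k, 0 <= f k) -> (i < N)%nat -> f i <= sumR N f.
Proof.
  intros Hf; induction N as [| N IH]; intros Hi; [lia |]; simpl.
  destruct (Nat.eq_dec i N) as [-> | Hne].
  - assert (0 <= sumR N f); [| lra].
    clear IH Hi; induction N as [| N IH]; simpl; [lra | specialize (Hf N); lra].
  - specialize (Hf N); specialize (IH ltac:(lia)); lra.
Qed.

Lemma sumR_bounded N M f c :
  0 <= c -> (forall k, f k <= c) -> (forall k, (M <= k)%nat -> f k = 0) ->
  sumR N f <= INR M * c.
Proof.
  intros Hc H1 H2.
  apply Rle_trans with (INR (Nat.min N M) * c).
  - induction N as [| N IH]; [simpl; lra |]; simpl sumR.
    destruct (Nat.lt_ge_cases N M) as [H | H].
    + replace (Nat.min (S N) M) with (S (Nat.min N M)) by lia.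
      rewrite S_INR; specialize (H1 N); lra.
    + replace (Nat.min (S N) M) with (Nat.min N M) by lia.
      rewrite (H2 N H); lra.
  - apply Rmult_le_compat_r; [exact Hc | apply le_INR; lia].
Qed.

Lemma coord_le_dist n (p q : Rn n) i :
  (i < n)%nat -> Rabs (coord p i - coord q i) <= distn p q.
Proof.
  intros Hi; unfold distn; rewrite <- sqrt_Rsqr_abs; apply sqrt_le_1_alt.
  replace (Rsqr (coord p i - coord q i)) with ((coord p i - coord q i) ^ 2)
    by (unfold Rsqr; ring).
  apply (sumR_term n (fun i => (coord p i - coord q i) ^ 2)); [| exact Hi].
  intros k; apply pow2_ge_0.
Qed.

Lemma dist_le n (p q : Rn n) e :
  (0 < n)%nat -> 0 <= e -> (forall i, (i < n)%nat -> Rabs (coord p i - coord q i) <= e) ->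
  distn p q <= INR n * e.
Proof.
  intros Hn He H.
  assert (Hn1 : 1 <= INR n) by (change 1 with (INR 1); apply le_INR; lia).
  unfold distn; rewrite <- (sqrt_Rsqr (INR n * e)) by nra.
  apply sqrt_le_1_alt.
  apply Rle_trans with (sumR n (fun _ => e ^ 2)).
  - apply sumR_le; intros k Hk; rewrite <- (pow2_abs (coord p k - coord q k)).
    apply pow_incr; split; [apply Rabs_pos | now apply H].
  - replace (sumR n (fun _ => e ^ 2)) with (INR n * e ^ 2).
    + unfold Rsqr; nra.
    + clear; induction n as [| n IH]; [simpl; lra |].
      rewrite S_INR; cbn [sumR]; rewrite <- IH; ring.
Qed.

(** * Cantor space mapped onto a cube *)

(** The coordinates are interleaved, so a prefix of length [n * m] is the same as [m] bits of each
    coordinate, that is, a dyadic cube. *)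
Definition slice (n i : nat) (x : cantor) : cantor := fun k => x (n * k + i)%nat.

Definition Phi (n : nat) (x : cantor) : Rn n.
Proof.
  exists (fun i => if Nat.ltb i n then val (/ 2) (slice n i x) else 0).
  intros i Hi; destruct (Nat.ltb_spec i n); [lia | reflexivity].
Defined.

Lemma coord_Phi n x i : (i < n)%nat -> coord (Phi n x) i = val (/ 2) (slice n i x).
Proof.
  intros Hi; unfold coord, Phi; simpl; destruct (Nat.ltb_spec i n); [reflexivity | lia].
Qed.

Lemma slice_pre n i x y m :
  (i < n)%nat -> pre x (n * m) = pre y (n * m) -> pre (slice n i x) m = pre (slice n i y) m.
Proof.
  intros Hi H; apply pre_ext; intros k Hk; apply (pre_bit x y (n * m) _ H); nia.
Qed.

Lemma pre_slices n x y m :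
  (forall i, (i < n)%nat -> pre (slice n i x) m = pre (slice n i y) m) ->
  pre x (n * m) = pre y (n * m).
Proof.
  intros H; apply pre_ext; intros j Hj.
  assert (Hn : (n <> 0)%nat) by (intros ->; lia).
  pose proof (Nat.div_mod j n Hn) as Hd.
  pose proof (Nat.mod_upper_bound j n Hn) as Hm.
  assert (Hq : (j / n < m)%nat) by (apply Nat.Div0.div_lt_upper_bound; exact Hj).
  rewrite Hd; exact (pre_bit _ _ m (j / n) (H (j mod n) Hm) Hq).
Qed.

Lemma Phi_close n x y m :
  (0 < n)%nat -> pre x (n * m) = pre y (n * m) ->
  distn (Phi n x) (Phi n y) <= INR n * (2 * (/ 2) ^ m).
Proof.
  intros Hn H; apply dist_le; [exact Hn | |].
  - assert (0 < (/ 2) ^ m) by (apply pow_lt; lra); lra.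
  - intros i Hi; rewrite !coord_Phi by exact Hi.
    apply val_close; [lra | now apply slice_pre].
Qed.

Fixpoint bin (b : cantor) (m : nat) : nat :=
  match m with O => O | S m => (2 * bin b m + if b m then 1 else 0)%nat end.

Lemma bin_psum b m : psum (/ 2) b m = 2 * INR (bin b m) * (/ 2) ^ m.
Proof.
  unfold psum; induction m as [| m IH]; [simpl; ring |].
  cbn [sumR bin pow]; rewrite IH, plus_INR, mult_INR; change (INR 2) with 2.
  destruct (b m); simpl INR; field.
Qed.

Lemma bin_inj b c m : bin b m = bin c m -> pre b m = pre c m.
Proof.
  induction m as [| m IH]; simpl; intros H; [reflexivity |].
  f_equal; [destruct (b m), (c m); (reflexivity || lia) | apply IH].
  destruct (b m), (c m); lia.
Qed.

(** If the dyadic indices differed by two or more, a whole interval of length [2 * (/ 2) ^ m] would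
    separate the values. *)
Lemma bin_close b c m :
  Rabs (val (/ 2) b - val (/ 2) c) <= (/ 2) ^ m -> (bin b m <= bin c m + 1)%nat.
Proof.
  intros H.
  pose proof (val_spec (/ 2) b ltac:(lra) m) as Hb.
  pose proof (val_spec (/ 2) c ltac:(lra) m) as Hc.
  rewrite bin_psum in Hb, Hc.
  assert (Hpos : 0 < (/ 2) ^ m) by (apply pow_lt; lra).
  pose proof (Rle_trans _ _ _ (Rle_abs _) H) as H'.
  destruct (Nat.le_gt_cases (bin b m) (bin c m + 1)) as [Hle | Hgt]; [exact Hle |].
  assert (Hg : INR (bin c m) + 2 <= INR (bin b m)).
  { replace 2 with (INR 2) by reflexivity; rewrite <- plus_INR; apply le_INR; lia. }
  exfalso; nra.
Qed.

Fixpoint tuples (n : nat) : list (list nat) :=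
  match n with
  | O => [[]]
  | S n => flat_map (fun a => map (cons a) (tuples n)) [0; 1; 2]%nat
  end.

Lemma tuples_length n : length (tuples n) = (3 ^ n)%nat.
Proof.
  induction n as [| n IH]; [reflexivity |].
  simpl; rewrite !length_app, !length_map, IH; simpl; lia.
Qed.

Lemma tuples_spec l : (forall a, In a l -> (a < 3)%nat) -> In l (tuples (length l)).
Proof.
  induction l as [| a l IH]; intros H; [now left |].
  cbn [length tuples]; apply in_flat_map; exists a; split.
  - assert (a < 3)%nat by (apply H; now left).
    destruct a as [| [| [| a]]]; simpl; auto; lia.
  - apply in_map, IH; intros b Hb; apply H; now right.
Qed.

(* In each coordinate, a set of diameter at most [(/ 2) ^ m] comes close to only three dyadic
   intervals of length [2 * (/ 2) ^ m]: the values of [bin] there differ by at most one. *)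
Lemma small_preimage n m (U : Rn n -> Prop) :
  (forall p q, U p -> U q -> distn p q <= (/ 2) ^ m) ->
  small (3 ^ n * (/ 2) ^ (n * m)) (fun s => exists x, U (Phi n x) /\ s = pre x (n * m)).
Proof.
  intros HU l Hl Hin.
  assert (Hlen : forall s, In s l -> length s = (n * m)%nat).
  { intros s Hs; destruct (Hin s Hs) as [x [_ ->]]; apply pre_length. }
  rewrite (mass_const_length (n * m) l Hlen).
  apply Rmult_le_compat_r; [apply pow_le; lra |].
  destruct l as [| s0 l0] eqn:El; [simpl; apply pow_le; lra |]; rewrite <- El in *.
  destruct (Hin s0) as [x0 [Hx0 _]]; [rewrite El; now left |]; clear El.
  set (pick := fun s => epsilon (inhabits x0) (fun x => U (Phi n x) /\ s = pre x (n * m))).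
  assert (Hpick : forall s, In s l -> U (Phi n (pick s)) /\ s = pre (pick s) (n * m)).
  { intros s Hs.
    exact (epsilon_spec (inhabits x0) (fun x => U (Phi n x) /\ s = pre x (n * m)) (Hin s Hs)). }
  set (B := fun i x => bin (slice n i x) m).
  (* The offset from the base point [x0] in each coordinate, shifted by one. By [HB] the subtraction
     is not truncated and the result is 0, 1 or 2. *)
  set (c := fun s => map (fun i => (B i (pick s) + 1 - B i x0)%nat) (seq 0 n)).
  assert (HB : forall s i, In s l -> (i < n)%nat ->
            (B i (pick s) <= B i x0 + 1)%nat /\ (B i x0 <= B i (pick s) + 1)%nat).
  { intros s i Hs Hi; destruct (Hpick s Hs) as [Hp _].
    split; apply bin_close; rewrite <- !(coord_Phi n) by exact Hi;
      (eapply Rle_trans; [now apply coord_le_dist | now apply HU]). }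
  replace (3 ^ n) with (INR (length (tuples n)))
    by (rewrite tuples_length, pow_INR; f_equal; simpl; ring).
  apply le_INR; rewrite <- (length_map c l).
  apply NoDup_incl_length.
  - apply Injective_map_NoDup_in; [| exact Hl].
    intros s t Hs Ht Heq.
    rewrite (proj2 (Hpick s Hs)), (proj2 (Hpick t Ht)).
    apply pre_slices; intros i Hi; apply bin_inj.
    assert (Hi' : In i (seq 0 n)) by (apply in_seq; lia).
    pose proof (ext_in_map Heq i Hi') as H; simpl in H.
    pose proof (HB s i Hs Hi); pose proof (HB t i Ht Hi); unfold B in *; lia.
  - intros t Ht; apply in_map_iff in Ht; destruct Ht as [s [<- Hs]].
    replace n with (length (c s)) at 1 by (unfold c; now rewrite length_map, length_seq).
    apply tuples_spec; intros a Ha; apply in_map_iff in Ha; destruct Ha as [i [<- Hi]].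
    apply in_seq in Hi; pose proof (HB s i Hs ltac:(lia)); lia.
Qed.

Lemma half_pow_small e : 0 < e -> exists m, (/ 2) ^ m < e.
Proof.
  intros He; destruct (pow_lt_1_zero (/ 2)) with (y := e) as [N HN]; [| exact He |].
  - rewrite Rabs_right; lra.
  - exists N; specialize (HN N (Nat.le_refl _)); rewrite Rabs_right in HN; [exact HN |].
    apply Rle_ge, pow_le; lra.
Qed.

(** For positive [d] take the last [m] with [d <= (/ 2) ^ m]; then [(/ 2) ^ m] is below [2 * d]. For
    [d = 0] the power vanishes and [e] has to bound the left side. *)
Lemma scale_exists n d e :
  (0 < n)%nat -> d <= 1 -> 0 < e ->
  exists m, d <= (/ 2) ^ m /\ (/ 2) ^ (n * m) <= 2 ^ n * rpow d (INR n) + e.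
Proof.
  intros Hn Hd He; unfold rpow; destruct (Rle_dec d 0) as [H | H].
  - destruct (half_pow_small e He) as [m Hm]; exists m.
    assert (0 < (/ 2) ^ m) by (apply pow_lt; lra).
    split; [lra |]; rewrite Rmult_0_r, Rplus_0_l.
    destruct n as [| n]; [lia |].
    replace (S n * m)%nat with (m + n * m)%nat by lia; rewrite pow_add.
    assert (0 <= (/ 2) ^ (n * m) <= 1).
    { split; [apply pow_le; lra |]. rewrite <- (pow1 (n * m)); apply pow_incr; lra. }
    nra.
  - apply Rnot_le_lt in H; rewrite Rpower_pow by exact H.
    assert (Hm : exists m, d <= (/ 2) ^ m /\ (/ 2) ^ S m < d).
    { destruct (half_pow_small d H) as [M HM].
      induction M as [| M IH]; [simpl in HM; lra |].
      destruct (Rlt_le_dec ((/ 2) ^ M) d) as [Hlt | Hle]; [now apply IH | now exists M]. }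
    destruct Hm as [m [Hm1 Hm2]]; exists m; split; [exact Hm1 |].
    rewrite Nat.mul_comm, pow_mult, <- Rpow_mult_distr.
    assert (((/ 2) ^ m) ^ n <= (2 * d) ^ n); [| lra].
    apply pow_incr; simpl in Hm2; split; [apply pow_le; lra | lra].
Qed.

(** * Dimension of the image *)

Definition image (n : nat) (A : cantor -> Prop) (p : Rn n) : Prop :=
  exists x, A x /\ p = Phi n x.

Lemma diam_bound n (U : Rn n -> Prop) d p q : diam_is U d -> U p -> U q -> distn p q <= d.
Proof.
  intros [[H _] | [H _]] Hp Hq; [destruct (H p Hp) |]. apply H; now exists p, q.
Qed.

Lemma Hnull_null n A : (0 < n)%nat -> Hnull (INR n) (image n A) -> null A.
Proof.
  intros Hn HA e He.
  set (c := 3 ^ n); assert (Hc : 0 < c) by (apply pow_lt; lra).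
  set (c2 := c * 2 ^ n).
  assert (Hc2 : 0 < c2) by (apply Rmult_lt_0_compat; [exact Hc | apply pow_lt; lra]).
  (* Diameters at most 1 permit [scale_exists]. Half of [e] is for the sum of powers, enlarged by
     the factor [c2], and half for the slack terms. *)
  destruct (HA 1 (e / 2 / c2)) as [U [d [Hcov [Hd Hsum]]]].
  { lra. }
  { apply Rdiv_lt_0_compat; lra. }
  assert (Hm : forall k, exists m, d k <= (/ 2) ^ m /\
     (/ 2) ^ (n * m) <= 2 ^ n * rpow (d k) (INR n) + e / 2 * (/ 2) ^ (k + 1) / c).
  { intros k; apply scale_exists; [exact Hn | apply Hd |].
    apply Rdiv_lt_0_compat; [| exact Hc].
    apply Rmult_lt_0_compat; [lra | apply pow_lt; lra]. }
  apply choice in Hm; destruct Hm as [m Hm].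
  exists (fun s => exists k x, U k (Phi n x) /\ s = pre x (n * m k)); split.
  - apply small_bigunion with
      (e := fun k => c2 * rpow (d k) (INR n) + e / 2 * (/ 2) ^ (k + 1)).
    + intros k; destruct (Hm k) as [H1 H2].
      apply small_le with (c * (/ 2) ^ (n * m k)).
      * apply (Rmult_le_compat_l c) in H2; [| lra].
        eapply Rle_trans; [exact H2 |]; unfold c2; right; field; lra.
      * apply small_preimage; intros p q Hp Hq.
        eapply Rle_trans; [| exact H1].
        apply (diam_bound n (U k)); auto; apply Hd.
    + intros N; rewrite (sumR_lin N c2 (fun k => rpow (d k) (INR n))).
      pose proof (sumR_half_le (e / 2) N ltac:(lra)) as H1.
      pose proof (Hsum N) as H2; apply (Rmult_le_compat_l c2) in H2; [| lra].
      replace (c2 * (e / 2 / c2)) with (e / 2) in H2 by (field; lra).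
      lra.
  - intros x Hx; destruct (Hcov (Phi n x)) as [k Hk]; [now exists x |].
    exists (n * m k)%nat, k, x; auto.
Qed.

Lemma Hnull_mono n (A : Rn n -> Prop) s t : s <= t -> Hnull s A -> Hnull t A.
Proof.
  intros Hst HA delta eps Hdelta Heps.
  (* Diameters at most 1 make the power decrease as the exponent grows. *)
  destruct (HA (Rmin delta 1) eps) as [U [d [Hcov [Hd Hsum]]]]; [| exact Heps |].
  { apply Rmin_pos; lra. }
  exists U, d; split; [exact Hcov | split].
  - intros k; destruct (Hd k) as [H1 H2]; split; [exact H1 |].
    pose proof (Rmin_l delta 1); lra.
  - intros N; apply Rle_trans with (2 := Hsum N), sumR_le; intros k _.
    destruct (Hd k) as [_ H2]; pose proof (Rmin_r delta 1).
    unfold rpow; destruct (Rle_dec (d k) 0) as [| Hpos]; [lra |].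
    unfold Rpower.
    assert (Hln : ln (d k) <= 0).
    { rewrite <- ln_1; destruct (Req_dec (d k) 1) as [-> | Hne]; [lra |].
      left; apply ln_increasing; lra. }
    assert (Hmul : t * ln (d k) <= s * ln (d k)) by nra.
    destruct Hmul as [Hlt | Heq]; [left; now apply exp_increasing | now rewrite Heq; right].
Qed.

Lemma diam_exists n (U : Rn n -> Prop) D :
  0 <= D -> (forall p q, U p -> U q -> distn p q <= D) -> exists d, diam_is U d /\ d <= D.
Proof.
  intros HD HU; destruct (classic (exists p, U p)) as [[p Hp] | Hno].
  - destruct (completeness (fun r => exists x y, U x /\ U y /\ r = distn x y)) as [d Hd].
    + exists D; intros r [x [y [Hx [Hy ->]]]]; auto.
    + exists (distn p p), p, p; auto.
    + exists d; split; [now right |].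
      apply Hd; intros r [x [y [Hx [Hy ->]]]]; auto.
  - exists 0; split; [left | exact HD]; split; [| reflexivity].
    intros x Hx; apply Hno; now exists x.
Qed.

(** The product is [C * exp (- (INR m * a))] with [a = (s - INR n) * ln 2] positive, and [exp]
    outgrows [C / eps]. Here [m1] serves the sum and [m2] the diameters. *)
Lemma scale_small n s delta eps :
  INR n < s -> 0 < delta -> 0 < eps ->
  exists m, INR n * (2 * (/ 2) ^ m) <= delta /\
    INR (2 ^ (n * m)) * Rpower ((INR n + 1) * (2 * (/ 2) ^ m)) s <= eps.
Proof.
  intros Hs Hdelta Heps.
  pose proof (pos_INR n) as Hn0.
  set (C := Rpower ((INR n + 1) * 2) s).
  assert (HC : 0 < C) by apply exp_pos.
  pose proof ln_lt_2 as Hln.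
  set (a := (s - INR n) * ln 2); assert (Ha : 0 < a) by (unfold a; nra).
  destruct (INR_unbounded (C / eps / a)) as [m1 Hm1].
  destruct (half_pow_small (delta / (2 * (INR n + 1)))) as [m2 Hm2].
  { apply Rdiv_lt_0_compat; lra. }
  set (m := Nat.max m1 m2); exists m.
  assert (Hm1' : C / eps < INR m * a).
  { assert (INR m1 <= INR m) by (apply le_INR; lia).
    apply Rle_lt_trans with (C / eps / a * a); [right; field; lra |].
    apply Rmult_lt_compat_r; lra. }
  assert (Hpos : 0 < (/ 2) ^ m) by (apply pow_lt; lra).
  assert (Hm2' : (/ 2) ^ m < delta / (2 * (INR n + 1))).
  { apply Rle_lt_trans with (2 := Hm2).
    replace m with (m2 + (m - m2))%nat by lia; rewrite pow_add.
    assert (0 <= (/ 2) ^ (m - m2) <= 1).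
    { split; [apply pow_le; lra |]. rewrite <- (pow1 (m - m2)); apply pow_incr; lra. }
    assert (0 < (/ 2) ^ m2) by (apply pow_lt; lra).
    nra. }
  split.
  - apply (Rmult_lt_compat_r (2 * (INR n + 1))) in Hm2'; [| lra].
    unfold Rdiv in Hm2'; rewrite Rmult_assoc, Rinv_l in Hm2'; nra.
  - rewrite pow_INR; change (INR 2) with 2.
    rewrite <- Rpower_pow by lra.
    rewrite <- Rmult_assoc.
    rewrite <- (Rpower_mult_distr ((INR n + 1) * 2) ((/ 2) ^ m) s) by nra.
    fold C.
    replace (Rpower ((/ 2) ^ m) s) with (Rpower 2 (- (INR m * s))).
    2: { rewrite <- (Rpower_pow m (/ 2)) by lra; rewrite Rpower_mult.
         unfold Rpower; rewrite ln_Rinv by lra; f_equal; ring. }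
    replace (Rpower 2 (INR (n * m)) * (C * Rpower 2 (- (INR m * s))))
      with (C * (Rpower 2 (INR (n * m)) * Rpower 2 (- (INR m * s)))) by ring.
    rewrite <- Rpower_plus, mult_INR; unfold Rpower.
    replace ((INR n * INR m + - (INR m * s)) * ln 2) with (- (INR m * a)) by (unfold a; ring).
    rewrite exp_Ropp.
    assert (He : C / eps < exp (INR m * a)) by (pose proof (exp_ineq1_le (INR m * a)); lra).
    apply (Rmult_le_reg_r (exp (INR m * a))); [apply exp_pos |].
    rewrite Rmult_assoc, Rinv_l by (apply Rgt_not_eq, exp_pos).
    apply (Rmult_lt_compat_r eps) in He; [| exact Heps].
    unfold Rdiv in He; rewrite Rmult_assoc, Rinv_l in He; lra.
Qed.

Lemma Hnull_image n A s : (0 < n)%nat -> INR n < s -> Hnull s (image n A).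
Proof.
  intros Hn Hs delta eps Hdelta Heps.
  destruct (scale_small n s delta eps Hs Hdelta Heps) as [m [Hm1 Hm2]].
  set (D := INR n * (2 * (/ 2) ^ m)) in *.
  assert (Hpos : 0 < (/ 2) ^ m) by (apply pow_lt; lra).
  assert (Hn1 : 1 <= INR n) by (change 1 with (INR 1); apply le_INR; lia).
  assert (HD : 0 < D) by (unfold D; nra).
  (* The images of the cylinders of length [n * m], indexed by position in [strings]; past the end
     of the list the sets are empty. *)
  set (U := fun (k : nat) (p : Rn n) => exists x, A x /\ p = Phi n x /\
              nth_error (strings (n * m)) k = Some (pre x (n * m))).
  assert (Hex : forall k, exists d, diam_is (U k) d /\ d <= D).
  { intros k; apply diam_exists; [lra |].
    intros p q [x [_ [-> Hx]]] [y [_ [-> Hy]]].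
    apply Phi_close; [exact Hn | congruence]. }
  apply choice in Hex; destruct Hex as [d Hd].
  exists U, d; split; [| split].
  - intros p [x [Hx ->]].
    destruct (In_nth_error (strings (n * m)) (pre x (n * m))) as [k Hk].
    { rewrite <- (pre_length x (n * m)) at 2; apply strings_spec. }
    exists k, x; auto.
  - intros k; split; [apply Hd |]. destruct (Hd k); lra.
  - intros N; apply Rle_trans with (2 := Hm2), sumR_bounded.
    + left; apply exp_pos.
    + intros k; unfold rpow; destruct (Rle_dec (d k) 0) as [| Hk]; [left; apply exp_pos |].
      destruct (Hd k) as [_ H]; apply Rle_Rpower_l; [lra |].
      unfold D in H; split; nra.
    + intros k Hk; rewrite <- strings_length in Hk.
      assert (Hempty : forall p, ~ U k p).
      { intros p [x [_ [_ Hx]]].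
        apply nth_error_None in Hk; rewrite Hk in Hx; discriminate. }
      (* Either form of [diam_is] gives an empty set a diameter at most 0, since 0 is an upper bound
         of the empty set of distances. *)
      unfold rpow; destruct (Rle_dec (d k) 0) as [| Hpos']; [reflexivity |].
      destruct (Hd k) as [[[_ H] | [_ H]] _]; [lra |].
      exfalso; apply Hpos', H; intros r [p [q [Hp _]]]; destruct (Hempty p Hp).
Qed.

Lemma dimH_image n A : (0 < n)%nat -> ~ null A -> dimH_eq (image n A) (INR n).
Proof.
  intros Hn HA; split.
  - intros s [Hs Hnull]; apply Rnot_lt_le; intros Hlt; apply HA, (Hnull_null n A Hn).
    apply Hnull_mono with (2 := Hnull); lra.
  - intros b Hb; apply Rnot_lt_le; intros Hlt.
    pose proof (pos_INR n).
    assert (b <= (INR n + b) / 2); [| lra].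
    apply Hb; split; [lra |]. apply Hnull_image; [exact Hn | lra].
Qed.

(** * Uniformly continuous functions as codes *)

Lemma unif_cont_Phi n A f :
  (0 < n)%nat -> unif_cont_on (image n A) f ->
  forall e, 0 < e -> exists L, forall x y, A x -> A y -> pre x L = pre y L ->
    Rabs (f (Phi n x) - f (Phi n y)) < e.
Proof.
  intros Hn Hf e He; destruct (Hf e He) as [delta [Hdelta H]].
  assert (HnR : 0 < INR n) by now apply lt_0_INR.
  destruct (half_pow_small (delta / (2 * INR n))) as [m Hm].
  { apply Rdiv_lt_0_compat; lra. }
  exists (n * m)%nat; intros x y Hx Hy Hxy.
  apply H; [now exists x | now exists y |].
  apply Rle_lt_trans with (1 := Phi_close n x y m Hn Hxy).
  apply (Rmult_lt_compat_r (2 * INR n)) in Hm; [| lra].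
  unfold Rdiv in Hm; rewrite Rmult_assoc, Rinv_l in Hm; lra.
Qed.

(** Codes the closure of the graph of [g] over [A], with values read through [val (/ 3)]. Its fibers
    are the level sets of the extension of [g] to the closure of [A]. *)
Definition graph_code (A : cantor -> Prop) (g : cantor -> R) : code :=
  fun s => match s with
    | false :: w =>
        if excluded_middle_informative
             (exists x u k, A x /\ g x = val (/ 3) u /\ w = pre x k ++ pre u k)
        then true else false
    | _ => false
    end.

Lemma graph_code_fiber A g u x :
  fiber (graph_code A g) u x <->
  forall k, exists y v, A y /\ g y = val (/ 3) v /\ pre y k = pre x k /\ pre v k = pre u k.
Proof.
  unfold fiber, graph_code; split; intros H k; specialize (H k).
  - destruct (excluded_middle_informative _) as [[y [v [j [Hy [Hg Heq]]]]] |]; [| discriminate].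
    assert (Hjk : j = k).
    { apply (f_equal (@length bool)) in Heq; rewrite !length_app, !pre_length in Heq; lia. }
    subst j; exists y, v.
    assert (Hp : pre x k = pre y k /\ pre u k = pre v k).
    { apply (f_equal (firstn k)) in Heq as H1; apply (f_equal (skipn k)) in Heq as H2.
      rewrite !firstn_app, !pre_length, Nat.sub_diag, !firstn_O, !app_nil_r in H1.
      rewrite !firstn_all2 in H1 by (rewrite pre_length; lia).
      rewrite !skipn_app, !pre_length, Nat.sub_diag in H2.
      rewrite (skipn_all2 (pre x k)), (skipn_all2 (pre y k)) in H2 by (rewrite pre_length; lia).
      split; assumption. }
    destruct Hp; auto.
  - destruct (excluded_middle_informative _) as [| Hn]; [reflexivity |].
    destruct H as [y [v [Hy [Hg [H1 H2]]]]]; exfalso; apply Hn.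
    exists y, v, k; rewrite H1, H2; auto.
Qed.

(** If points of two fibers shared a long prefix, nearby points of [A] would have values of [g] that
    are close to each other and also close to [val (/ 3) u] and [val (/ 3) v]. The three errors are
    each below [e / 3]. *)
Lemma graph_code_separated A g :
  (forall e, 0 < e -> exists L, forall x y, A x -> A y -> pre x L = pre y L ->
     Rabs (g x - g y) < e) ->
  separated (fiber (graph_code A g)).
Proof.
  intros Hg u v Huv.
  set (e := Rabs (val (/ 3) u - val (/ 3) v)).
  assert (He : 0 < e).
  { apply Rabs_pos_lt; intros H; apply Huv, val_third_inj; lra. }
  destruct (Hg (e / 3)) as [L HL]; [lra |].
  destruct (pow_lt_1_zero (/ 3)) with (y := e / 6) as [M HM];
    [rewrite Rabs_right; lra | lra |].
  exists L; intros x y Hx Hy Hxy.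
  set (k := Nat.max L M).
  specialize (HM k ltac:(lia)); rewrite Rabs_right in HM by (apply Rle_ge, pow_le; lra).
  rewrite graph_code_fiber in Hx.
  rewrite graph_code_fiber in Hy.
  destruct (Hx k) as [x' [u' [Ax [Gx [Px Pu]]]]], (Hy k) as [y' [v' [Ay [Gy [Py Pv]]]]].
  assert (Hl : Rabs (g x' - g y') < e / 3).
  { apply HL; auto.
    rewrite (pre_le x' x L k), (pre_le y' y L k); auto; lia. }
  pose proof (val_close (/ 3) u' u k ltac:(lra) Pu) as H1.
  pose proof (val_close (/ 3) v' v k ltac:(lra) Pv) as H2.
  rewrite Gx, Gy in Hl.
  assert (Ht : e <= Rabs (val (/ 3) u' - val (/ 3) u) +
                    Rabs (val (/ 3) u' - val (/ 3) v') + Rabs (val (/ 3) v' - val (/ 3) v)).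
  { unfold e; unfold Rabs; repeat destruct (Rcase_abs _); lra. }
  lra.
Qed.

Theorem theorem3p2 :
  covM_eq_c ->
  forall n : nat, (0 < n)%nat ->
  exists A : Rn n -> Prop,
    dimH_eq A (INR n) /\
    ~ (exists (f : Rn n -> R) (a b : R),
         a < b /\ unif_cont_on A f /\ maps_onto A f a b).
Proof.
  intros Hcov n Hn.
  destruct (cantor_set Hcov) as [A [HA HP]].
  exists (image n A); split; [now apply dimH_image |].
  intros [f [a [b [Hab [Hf [_ Honto]]]]]].
  (* Rescales the target interval to [[0, 2]], which contains every [val (/ 3) u]. *)
  set (g := fun x => (f (Phi n x) - a) * (2 / (b - a))).
  assert (Hg : separated (fiber (graph_code A g))).
  { apply graph_code_separated; intros e He.
    destruct (unif_cont_Phi n A f Hn Hf (e * ((b - a) / 2))) as [L HL].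
    { apply Rmult_lt_0_compat; lra. }
    exists L; intros x y Hx Hy Hxy; specialize (HL x y Hx Hy Hxy).
    unfold g; rewrite <- Rmult_minus_distr_r, Rabs_mult.
    replace (f (Phi n x) - a - (f (Phi n y) - a)) with (f (Phi n x) - f (Phi n y)) by ring.
    assert (H2 : 0 < 2 / (b - a)) by (apply Rdiv_lt_0_compat; lra).
    rewrite (Rabs_right (2 / (b - a))) by lra.
    apply Rlt_le_trans with (e * ((b - a) / 2) * (2 / (b - a))).
    - now apply Rmult_lt_compat_r.
    - right; field; lra. }
  destruct (HP _ Hg) as [u Hu].
  pose proof (val_range (/ 3) u ltac:(lra)) as Hr.
  (* Surjectivity yields [x] in [A] with [g x = val (/ 3) u]. The pair of [x] and [u] is then in the
     graph, which puts [x] in the fiber that [A] avoids. *)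
  destruct (Honto (a + val (/ 3) u * ((b - a) / 2))) as [p [[x [Hx ->]] Hfx]].
  { split; nra. }
  apply (Hu x Hx), graph_code_fiber; intros k; exists x, u; repeat split; auto.
  unfold g; rewrite Hfx; field; lra.
Qed.
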